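(* Let $f:\mathbb Z^3\to\mathbb R^N$ be a Q-net with non-degenerate elementary hexahedra (for every $u$ the points $f,f_1,f_2,f_3$ span a $3$-dimensional affine subspace, and the hexahedron is in general position). For each elementary hexahedron with vertices $f,f_i,f_{ij},f_{123}$, the four vertices $f,f_{12},f_{23},f_{13}$ are coplanar if and only if the four vertices $f_1,f_2,f_3,f_{123}$ are coplanar. Moreover, $f$ is a discrete Koenigs net if and only if for every elementary hexahedron these (equivalent) coplanarity conditions hold.
   Context: Let $N\ge 3$. For a map $f:\mathbb Z^3\to\mathbb R^N$, write $e_i$ for the $i$-th unit vector, $f=f(u)$, $f_i=f(u+e_i)$, $f_{ij}=f(u+e_i+e_j)$, $f_{123}=f(u+e_1+e_2+e_3)$, $\delta_i f=f_i-f$. A Q-net is a map such that for every $u$ and $i\ne j$ the elementary quadrilateral $(f,f_i,f_{ij},f_j)$ is planar; elementary quadrilaterals are assumed non-degenerate: four distinct vertices, no three collinear, and the diagonals $(ff_{ij})$, $(f_if_j)$ meet in a point different from all vertices. Two planar quadrilaterals $(A,B,C,D)$, $(A^*,B^*,C^*,D^* )$ are dual if corresponding sides are parallel ($A^*B^*\parallel AB$, $B^*C^*\parallel BC$, $C^*D^*\parallel CD$, $D^*A^*\parallel DA$) and non-corresponding diagonals are parallel ($A^*C^*\parallel BD$, $B^*D^*\parallel AC$). A Q-net $f$ is a discrete Koenigs net if there is a Q-net $f^*$ (a dual net) such that each $(f^*,f^*_i,f^*_{ij},f^*_j)$ is dual to $(f,f_i,f_{ij},f_j)$, i.e. $\delta_if^*\parallel\delta_if$,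 $\delta_jf^*\parallel\delta_jf$, $f^*_{ij}-f^*\parallel f_i-f_j$, $f^*_i-f^*_j\parallel f_{ij}-f$. *)

(* Defs.v *)
From HB Require Import structures.
From mathcomp Require Import all_boot all_order all_algebra.
Set Implicit Arguments. Unset Strict Implicit. Unset Printing Implicit Defensive.
Import Order.TTheory GRing.Theory Num.Theory.
Local Open Scope ring_scope.

Section Geometry.
Variables (R : realFieldType) (N : nat).
Notation pt := 'rV[R]_N.

Definition coplanar4 (A B C D : pt) : Prop :=
  (\rank (col_mx (B - A) (col_mx (C - A) (D - A))) <= 2)%N.

Definition spans3 (A B C D : pt) : Prop :=
  \rank (col_mx (B - A) (col_mx (C - A) (D - A))) = 3%N.

Definition collinear3 (A B C : pt) : Prop :=
  (\rank (col_mx (B - A) (C - A)) <= 1)%N.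

Definition parallel (u v : pt) : Prop := (\rank (col_mx u v) <= 1)%N.

Definition on_line (X Y P : pt) : Prop := exists s : R, P = X + s *: (Y - X).

Definition nondeg_quad (A B C D : pt) : Prop :=
  (A <> B /\ A <> C /\ A <> D /\ B <> C /\ B <> D /\ C <> D) /\
  (~ collinear3 A B C /\ ~ collinear3 A B D /\ ~ collinear3 A C D /\
   ~ collinear3 B C D) /\
  (exists P, on_line A C P /\ on_line B D P /\
             P <> A /\ P <> B /\ P <> C /\ P <> D).

Definition dual_quad (A B C D A' B' C' D' : pt) : Prop :=
  parallel (B' - A') (B - A) /\ parallel (C' - B') (C - B) /\
  parallel (D' - C') (D - C) /\ parallel (A' - D') (A - D) /\
  parallel (C' - A') (D - B) /\ parallel (D' - B') (C - A).
End Geometry.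

Definition Z3 := 'rV[int]_3.
Definition e (i : 'I_3) : Z3 := delta_mx 0 i.
Definition i1 : 'I_3 := @Ordinal 3 0 isT.
Definition i2 : 'I_3 := @Ordinal 3 1 isT.
Definition i3 : 'I_3 := @Ordinal 3 2 isT.

Section Nets.
Variables (R : realFieldType) (N : nat).
Notation pt := 'rV[R]_N.

Definition Qnet (f : Z3 -> pt) : Prop :=
  forall (u : Z3) (i j : 'I_3), i != j ->
    coplanar4 (f u) (f (u + e i)) (f (u + e i + e j)) (f (u + e j)) /\
    nondeg_quad (f u) (f (u + e i)) (f (u + e i + e j)) (f (u + e j)).

Definition koenigs (f : Z3 -> pt) : Prop :=
  exists fs : Z3 -> pt, Qnet fs /\
    forall (u : Z3) (i j : 'I_3), i != j ->
      dual_quad (f u) (f (u + e i)) (f (u + e i + e j)) (f (u + e j))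
                (fs u) (fs (u + e i)) (fs (u + e i + e j)) (fs (u + e j)).

Definition hexv (f : Z3 -> pt) (u : Z3) (a b c : bool) : pt :=
  f (u + e i1 *+ a + e i2 *+ b + e i3 *+ c).

(* non-degenerate elementary hexahedron: f, f1, f2, f3 span a 3-space and
   (general position) at every vertex the vertex and its three neighbours
   span a 3-dimensional affine subspace *)
Definition nondeg_hex (f : Z3 -> pt) (u : Z3) : Prop :=
  spans3 (f u) (f (u + e i1)) (f (u + e i2)) (f (u + e i3)) /\
  forall a b c : bool,
    spans3 (hexv f u a b c) (hexv f u (~~ a) b c)
           (hexv f u a (~~ b) c) (hexv f u a b (~~ c)).

Definition black_coplanar (f : Z3 -> pt) (u : Z3) : Prop :=
  coplanar4 (f u) (f (u + e i1 + e i2)) (f (u + e i2 + e i3)) (f (u + e i1 + e i3)).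

Definition white_coplanar (f : Z3 -> pt) (u : Z3) : Prop :=
  coplanar4 (f (u + e i1)) (f (u + e i2)) (f (u + e i3))
            (f (u + e i1 + e i2 + e i3)).
End Nets.

(* Main.v *)
From Stdlib Require Import IndefiniteDescription.
Require Import Defs.
From HB Require Import structures.
From mathcomp Require Import all_boot all_order all_algebra.
From mathcomp Require Import ring.
Import Order.TTheory GRing.Theory Num.Theory.
Local Open Scope ring_scope.
Set Implicit Arguments. Unset Strict Implicit. Unset Printing Implicit Defensive.

(** If the black vertices of a cube are coplanar, their dependency rescales the
    homogeneous lifts of the eight vertices by factors k so that all six faces
    satisfy the discrete Moutard equation [F_ij - F = m (F_i - F_j)].  Then the
    lift of f_123 is a combination of those of f_1, f_2, f_3, so the white
    vertices are coplanar too; the converse is the same fact for the reflected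
    cube.  Scaling each edge of a face by the product of the factors k at its
    ends gives a dual quadrilateral, which is unique up to scale.  Hence the
    scales of the dual cubes form a closed multiplicative 1-form on Z^3 (the
    four cubes around an edge share that edge); integrating it, and then the
    resulting closed vector-valued 1-form, produces the dual net.  Conversely,
    for a dual net f^* the vectors f_ij - f are multiples of f^*_j - f^*_i,
    which sum to zero around the triangle f^*_1, f^*_2, f^*_3. *)

(** * Rank bounds as linear dependencies *)

Section LinearDependence.
Variables (F : fieldType) (N : nat).

Lemma rank_ltP m (A : 'M[F]_(m, N)) :
  reflect (exists2 w : 'rV_m, w != 0 & w *m A = 0) (\rank A < m)%N.
Proof.
have -> : (\rank A < m)%N = ~~ row_free A.
  by rewrite /row_free ltn_neqAle rank_leq_row andbT.
rewrite -kermx_eq0.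
apply: (iffP rowV0Pn) => [[w /sub_kermxP wA w0]|[w w0 wA]]; exists w => //.
exact/sub_kermxP.
Qed.

Lemma mul_mx11_row (a : 'M[F]_1) (u : 'rV[F]_N) : a *m u = a 0 0 *: u.
Proof. by rewrite {1}[a]mx11_scalar mul_scalar_mx. Qed.

Lemma rank_col2P (u v : 'rV[F]_N) : (\rank (col_mx u v) <= 1)%N <->
  exists x y : F, (x != 0) || (y != 0) /\ x *: u + y *: v = 0.
Proof.
split=> [/(@rank_ltP (1 + 1))[w w0 wA]|[x [y [xy uv]]]].
  exists (lsubmx w 0 0), (rsubmx w 0 0); move: w0 wA.
  rewrite -{1 2}[w]hsubmxK mul_row_col !mul_mx11_row row_mx_eq0 => w0 ->.
  split=> //; apply: contraNT w0; rewrite negb_or !negbK => /andP[/eqP x0 /eqP y0].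
  by rewrite [lsubmx w]mx11_scalar [rsubmx w]mx11_scalar x0 y0 raddf0 eqxx.
apply/(@rank_ltP (1 + 1)); exists (row_mx x%:M y%:M).
  rewrite row_mx_eq0 negb_and; case/orP: xy => h; apply/orP; [left|right];
  by apply: contraNneq h => /matrixP/(_ 0 0); rewrite !mxE eqxx mulr1n => ->.
by rewrite mul_row_col !mul_scalar_mx.
Qed.

Lemma rank_col3P (u v w : 'rV[F]_N) :
  (\rank (col_mx u (col_mx v w)) <= 2)%N <->
  exists x y z : F, [|| x != 0, y != 0 | z != 0] /\
    x *: u + y *: v + z *: w = 0.
Proof.
split=> [/(@rank_ltP (1 + (1 + 1)))[c c0 cA]|[x [y [z [xyz uvw]]]]].
  exists (lsubmx c 0 0), (lsubmx (rsubmx c) 0 0), (rsubmx (rsubmx c) 0 0).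
  move: c0 cA.
  rewrite -{1 2}[c]hsubmxK -{1 2}[rsubmx c]hsubmxK !mul_row_col !mul_mx11_row.
  rewrite !row_mx_eq0 addrA => c0 ->; split=> //; apply: contraNT c0.
  rewrite !negb_or !negbK => /and3P[/eqP x0 /eqP y0 /eqP z0].
  rewrite [lsubmx c]mx11_scalar [lsubmx (rsubmx c)]mx11_scalar.
  by rewrite [rsubmx (rsubmx c)]mx11_scalar x0 y0 z0 raddf0 eqxx.
apply/(@rank_ltP (1 + (1 + 1))).
exists (row_mx x%:M (row_mx y%:M z%:M)); last first.
  by rewrite !mul_row_col !mul_scalar_mx addrA.
rewrite !row_mx_eq0 !negb_and.
by case/or3P: xyz => h; apply/or3P; [constructor 1|constructor 2|constructor 3];
  apply: contraNneq h => /matrixP/(_ 0 0); rewrite !mxE eqxx mulr1n => ->.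
Qed.

End LinearDependence.

(** * Spanning conditions and diagonals of quadrilaterals *)

Section Points.
Context {R : realFieldType} {N : nat}.
Implicit Types A B C D O P Q u v w : 'rV[R]_N.

Lemma spans3_free A B C D x y z : spans3 A B C D ->
  x *: (B - A) + y *: (C - A) + z *: (D - A) = 0 -> [/\ x = 0, y = 0 & z = 0].
Proof.
rewrite /spans3 => r3 e0.
have : ~ (\rank (col_mx (B - A) (col_mx (C - A) (D - A))) <= 2)%N by rewrite r3.
move=> h; have [/or3P hn|] := boolP [|| x != 0, y != 0 | z != 0].
  by case: h; apply/rank_col3P; exists x, y, z; split=> //; apply/or3P.
by rewrite !negb_or !negbK => /and3P[/eqP -> /eqP -> /eqP ->].
Qed.

Lemma collinear3_free A B C x y : ~ collinear3 A B C ->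
  x *: (B - A) + y *: (C - A) = 0 -> x = 0 /\ y = 0.
Proof.
move=> h e0; have [hn|] := boolP ((x != 0) || (y != 0)).
  by case: h; apply/rank_col2P; exists x, y.
by rewrite !negb_or !negbK => /andP[/eqP -> /eqP ->].
Qed.

Lemma spans3_perm A B C D : spans3 A B C D -> spans3 A C D B.
Proof.
move=> h; apply/eqP; rewrite eqn_leq (rank_leq_row (_ : 'M_(1 + (1 + 1), _))).
rewrite ltnNge; apply/negP => /rank_col3P[x [y [z [n0 e0]]]].
have [] := spans3_free (x := z) (y := x) (z := y) h; first by rewrite -addrA addrC.
by move=> z0 x0 y0; move: n0; rewrite x0 y0 z0 eqxx.
Qed.

(** Affine parameters of the common point of the diagonals; excluding 0 and 1 keeps it off the
    vertices. Planarity is implied, and the condition is stable under the symmetries of the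
    quadrilateral. *)
Definition quad_diag A B C D : Prop :=
  exists s t, [/\ s != 0, s != 1, t != 0 & t != 1] /\
    (1 - s) *: A + s *: C = (1 - t) *: B + t *: D.

Lemma nondeg_quad_diag A B C D : nondeg_quad A B C D -> quad_diag A B C D.
Proof.
move=> [_ [_ [P [[s Ps] [[t Pt] [PA [PB [PC PD]]]]]]]].
exists s, t; split.
  split; apply/eqP => e0.
  - by apply: PA; rewrite Ps e0 scale0r addr0.
  - by apply: PC; rewrite Ps e0 scale1r addrC subrK.
  - by apply: PB; rewrite Pt e0 scale0r addr0.
  - by apply: PD; rewrite Pt e0 scale1r addrC subrK.
transitivity P; first by rewrite Ps; apply/rowP=> k; rewrite !mxE; ring.
by rewrite Pt; apply/rowP=> k; rewrite !mxE; ring.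
Qed.

Lemma quad_diag_flip A B C D : quad_diag A B C D -> quad_diag A D C B.
Proof.
move=> [s [t [[s0 s1 t0 t1] e0]]]; exists s, (1 - t); split.
  by split=> //; rewrite ?subr_eq0 1?eq_sym // -subr_eq0 opprB addrC subrK.
by rewrite e0 addrC subKr.
Qed.

Lemma quad_diag_rot A B C D : quad_diag A B C D -> quad_diag B C D A.
Proof.
move=> [s [t [[s0 s1 t0 t1] e0]]]; exists t, (1 - s); split.
  by split=> //; rewrite ?subr_eq0 1?eq_sym // -subr_eq0 opprB addrC subrK.
by rewrite subKr -e0 addrC.
Qed.

(** * Moutard lifts of a cube and of its faces *)

Lemma eq0_of_lincomb (a b x y : R) : a != 0 -> b != 0 ->
  x * a + y * b = 0 -> (x == 0) = (y == 0).
Proof.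
move=> a0 b0 /eqP; rewrite addr_eq0 => /eqP e0.
by rewrite -(mulrI_eq0 x (lregP a0)) mulrC e0 oppr_eq0 mulf_eq0 (negbTE b0) orbF.
Qed.

Lemma coplanar4_swap A B C D : coplanar4 A B C D -> coplanar4 A B D C.
Proof.
move=> /rank_col3P[x [y [z [n0 e0]]]]; apply/rank_col3P; exists x, z, y.
by rewrite [(z != 0) || _]orbC addrAC.
Qed.

(** The diagonals express each black vector in two of the independent vectors [Pi - O]. In a
    dependency of the black vectors, each [Pi - O] occurs twice, with opposite coefficients [ai] and
    [- ai]. *)
Lemma black_coeffs O P1 P2 P3 P12 P23 P31 :
  spans3 O P1 P2 P3 -> quad_diag O P1 P12 P2 -> quad_diag O P2 P23 P3 ->
  quad_diag O P3 P31 P1 -> coplanar4 O P12 P23 P31 ->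
  exists x y z a1 a2 a3 : R,
    [/\ [/\ x != 0, y != 0 & z != 0], [/\ a1 != 0, a2 != 0 & a3 != 0],
        [/\ x - a1 + a2 != 0, y - a2 + a3 != 0 & z - a3 + a1 != 0]
      & [/\ x *: (P12 - O) = a1 *: (P1 - O) - a2 *: (P2 - O),
            y *: (P23 - O) = a2 *: (P2 - O) - a3 *: (P3 - O)
          & z *: (P31 - O) = a3 *: (P3 - O) - a1 *: (P1 - O)]].
Proof.
move=> S0 [s3 [t3 [[s30 s31 t30 t31] e3]]] [s1 [t1 [[s10 s11 t10 t11] e1]]].
move=> [s2 [t2 [[s20 s21 t20 t21] e2]]] /rank_col3P[x [y [z [n0 e0]]]].
have dE s t (A B C D : 'rV[R]_N) : s != 0 ->
    (1 - s) *: A + s *: C = (1 - t) *: B + t *: D ->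
    C - A = s^-1 *: ((1 - t) *: (B - A) + t *: (D - A)).
  move=> s0 /rowP h; apply/rowP => k; move: (h k); rewrite !mxE => hk.
  have -> : C 0 k = ((1 - t) * B 0 k + t * D 0 k - (1 - s) * A 0 k) / s.
    by rewrite -hk; field.
  by field.
have E3 := dE _ _ _ _ _ _ s30 e3; have E1 := dE _ _ _ _ _ _ s10 e1.
have E2 := dE _ _ _ _ _ _ s20 e2.
pose x' := x / s3; pose y' := y / s1; pose z' := z / s2.
have xE : x = x' * s3 by rewrite divfK.
have yE : y = y' * s1 by rewrite divfK.
have zE : z = z' * s2 by rewrite divfK.
have [] := @spans3_free O P1 P2 P3 (x' * (1 - t3) + z' * t2)
   (x' * t3 + y' * (1 - t1)) (y' * t1 + z' * (1 - t2)) S0.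
  rewrite -e0 E1 E2 E3 /x' /y' /z'; apply/rowP => k; rewrite !mxE; field.
  by rewrite s10 s20 s30.
move=> f1 f2 f3.
have nz (t : R) : t != 1 -> 1 - t != 0 by rewrite subr_eq0 eq_sym.
clearbody x' y' z'.
(* The cancellations link [x'], [y'], [z'] in pairs, so they vanish together; as the dependency is
   nontrivial, none of them vanishes. *)
have xz := eq0_of_lincomb (nz _ t31) t20 f1.
have xy := eq0_of_lincomb t30 (nz _ t11) f2.
have x0 : x' != 0.
  apply/negP => x'0; move: xz xy; rewrite x'0 => /esym/eqP z0 /esym/eqP y0.
  by move: n0; rewrite xE yE zE z0 y0 (eqP x'0) !mul0r eqxx.
have y0 : y' != 0 by rewrite -xy.
have z0 : z' != 0 by rewrite -xz.
have f1' : x' * (1 - t3) = - (z' * t2) by apply/eqP; rewrite -addr_eq0 f1.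
have f2' : x' * t3 = - (y' * (1 - t1)) by apply/eqP; rewrite -addr_eq0 f2.
have f3' : y' * t1 = - (z' * (1 - t2)) by apply/eqP; rewrite -addr_eq0 f3.
exists x, y, z, (x' * (1 - t3)), (y' * (1 - t1)), (z' * (1 - t2)).
split.
- by split; rewrite ?xE ?yE ?zE mulf_neq0.
- by split; rewrite mulf_neq0 ?nz.
- have sub1 (t : R) : t != 1 -> t - 1 != 0 by rewrite subr_eq0.
  split.
  (* This total weight is nonzero because the diagonals do not meet at [P12]; the next two cases are
     cyclic copies. *)
  + have -> : x - x' * (1 - t3) + y' * (1 - t1) = x' * (s3 - 1).
      by rewrite xE -[y' * _]opprK -f2'; ring.
    by rewrite mulf_neq0 ?sub1.
  + have -> : y - y' * (1 - t1) + z' * (1 - t2) = y' * (s1 - 1).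
      by rewrite yE -[z' * _]opprK -f3'; ring.
    by rewrite mulf_neq0 ?sub1.
  + have -> : z - z' * (1 - t2) + x' * (1 - t3) = z' * (s2 - 1).
      by rewrite zE f1'; ring.
    by rewrite mulf_neq0 ?sub1.
- split.
  + rewrite E3 -scaleNr -f2' xE; apply/rowP => k; rewrite !mxE; by field.
  + rewrite E1 -scaleNr -f3' yE; apply/rowP => k; rewrite !mxE; by field.
  + rewrite E2 f1' zE; apply/rowP => k; rewrite !mxE; by field.
Qed.

(* [kA], ..., [kD] rescale the homogeneous lifts of the vertices to a solution
   of the discrete Moutard equation [C^ - A^ = m (B^ - D^)]. *)
Definition moutard (kA kB kC kD : R) A B C D : Prop :=
  [/\ kA != 0, kB != 0, kC != 0 & kD != 0] /\ exists2 m : R,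
    kC - kA = m * (kB - kD) & kC *: C - kA *: A = m *: (kB *: B - kD *: D).

Lemma moutard_flip kA kB kC kD A B C D :
  moutard kA kB kC kD A B C D -> moutard kA kD kC kB A D C B.
Proof.
move=> [[? ? ? ?] [m e1 e2]]; split=> //; exists (- m).
  by rewrite e1 mulNr -mulrN opprB.
by rewrite e2 scaleNr -scalerN opprB.
Qed.

Lemma three_planes u1 u2 u3 v a b c d g h :
  (forall x y z, x *: u1 + y *: u2 + z *: u3 = 0 -> [/\ x = 0, y = 0 & z = 0]) ->
  v = a *: u1 + b *: u2 -> v = c *: u2 + d *: u3 -> v = g *: u3 + h *: u1 ->
  v = 0.
Proof.
move=> fr e1 e2 e3.
have [|a0 _ _] := fr a (b - c) (- d).
  rewrite -[RHS](subrr v) {1}e1 e2; apply/rowP => k; rewrite !mxE; ring.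
have [|_ b0 _] := fr (a - h) b (- g).
  rewrite -[RHS](subrr v) {1}e1 e3; apply/rowP => k; rewrite !mxE; ring.
by rewrite e1 a0 b0 !scale0r addr0.
Qed.

(** Total weight zero makes [v] a direction of the plane of the face. The diagonal relation
    eliminates [P1]; the divisor [1 - s] is nonzero because the diagonals do not meet at [Q]. *)
Lemma upper_plane P1 P12 Q P31 v (x y z w : R) : quad_diag P1 P12 Q P31 ->
  v = x *: P1 + y *: P12 + z *: P31 - w *: Q -> x + y + z = w ->
  exists a b, v = a *: (P31 - Q) + b *: (P12 - Q).
Proof.
move=> [s [t [[s0 s1 t0 t1] /rowP e0]]] -> <-.
have s1' : 1 - s != 0 by rewrite subr_eq0 eq_sym.
exists (z + x * t / (1 - s)), (y + x * (1 - t) / (1 - s)).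
apply/rowP => k; move: (e0 k); rewrite !mxE => hk.
have -> : P1 0 k = ((1 - t) * P12 0 k + t * P31 0 k - s * Q 0 k) / (1 - s).
  by rewrite -hk; field.
by field.
Qed.

Lemma cube_moutard O P1 P2 P3 P12 P23 P31 Q :
  spans3 O P1 P2 P3 -> spans3 Q P12 P23 P31 ->
  quad_diag O P1 P12 P2 -> quad_diag O P2 P23 P3 -> quad_diag O P3 P31 P1 ->
  quad_diag P1 P12 Q P31 -> quad_diag P2 P23 Q P12 -> quad_diag P3 P31 Q P23 ->
  coplanar4 O P12 P23 P31 ->
  coplanar4 P1 P2 P3 Q /\
  exists k k1 k2 k3 k12 k23 k31 k123 : R,
   [/\ moutard k k1 k12 k2 O P1 P12 P2, moutard k k2 k23 k3 O P2 P23 P3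
     & moutard k k3 k31 k1 O P3 P31 P1] /\
   [/\ moutard k1 k12 k123 k31 P1 P12 Q P31,
       moutard k2 k23 k123 k12 P2 P23 Q P12
     & moutard k3 k31 k123 k23 P3 P31 Q P23].
Proof.
move=> S0 SQ q12 q23 q31 q1 q2 q3 cop.
have [x [y [z [a1 [a2 [a3 [[x0 y0 z0] [a10 a20 a30] []]]]]]]] :=
  black_coeffs S0 q12 q23 q31 cop.
set A := x - a1 + a2; set B := y - a2 + a3; set C := z - a3 + a1.
move=> A0 B0 C0 [ex ey ez].
(* The weights of [V] are chosen so that [O] cancels when two of the [Pi] are traded for two black
   vertices, as in [V1], [V2], [V3]. [W] is the total weight of [V], and [S = A + B + C]. *)
pose W := B * a1 + C * a2 + A * a3; pose S := x + y + z.
pose V := (B * a1) *: P1 + (C * a2) *: P2 + (A * a3) *: P3.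
have E12 : P12 = O + x^-1 *: (a1 *: (P1 - O) - a2 *: (P2 - O)).
  by rewrite -ex scalerA mulVf // scale1r addrC subrK.
have E23 : P23 = O + y^-1 *: (a2 *: (P2 - O) - a3 *: (P3 - O)).
  by rewrite -ey scalerA mulVf // scale1r addrC subrK.
have E31 : P31 = O + z^-1 *: (a3 *: (P3 - O) - a1 *: (P1 - O)).
  by rewrite -ez scalerA mulVf // scale1r addrC subrK.
have V1 : V = (S * a1) *: P1 + (- (C * x)) *: P12 + (A * z) *: P31.
  rewrite /V E12 E31; apply/rowP => k; rewrite !mxE /A /B /C /S; field.
  by rewrite x0 z0.
have V2 : V = (S * a2) *: P2 + (- (A * y)) *: P23 + (B * x) *: P12.
  rewrite /V E12 E23; apply/rowP => k; rewrite !mxE /A /B /C /S; field.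
  by rewrite x0 y0.
have V3 : V = (S * a3) *: P3 + (- (B * z)) *: P31 + (C * y) *: P23.
  rewrite /V E31 E23; apply/rowP => k; rewrite !mxE /A /B /C /S; field.
  by rewrite y0 z0.
(* By [V1], [V2], [V3] this vector is parallel to all three faces at [Q], whose edge directions
   there are independent. *)
have VQ : V - W *: Q = 0.
  have [|a [b eab]] := upper_plane (v := V - W *: Q) q1 (congr1 (fun v => v - W *: Q) V1).
    by rewrite /W /A /B /C /S; ring.
  have [|c [d ecd]] := upper_plane (v := V - W *: Q) q2 (congr1 (fun v => v - W *: Q) V2).
    by rewrite /W /A /B /C /S; ring.
  have [|g [h egh]] := upper_plane (v := V - W *: Q) q3 (congr1 (fun v => v - W *: Q) V3).
    by rewrite /W /A /B /C /S; ring.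
  have fr := spans3_free (spans3_perm (spans3_perm SQ)).
  exact: (three_planes fr eab ecd egh).
have VE : V = W *: Q by apply/eqP; rewrite -subr_eq0 VQ.
have W0 : W != 0.
  apply/negP => /eqP W0; move: VE; rewrite W0 scale0r => V0.
  have [|_ /eqP] := @spans3_free O P1 P2 P3 (B * a1) (C * a2) (A * a3) S0.
    have -> : 0 = V - W *: O by rewrite V0 W0 scale0r subrr.
    by rewrite /V /W; apply/rowP => k; rewrite !mxE; ring.
  by rewrite mulf_eq0 (negbTE C0) (negbTE a20).
have S00 : S != 0.
  apply/negP => /eqP S00; move: VE; rewrite V1 S00 mul0r scale0r add0r => VE'.
  have [|/eqP] := @spans3_free Q P12 P23 P31 (- (C * x)) 0 (A * z) SQ.
    have -> : 0 = W *: Q - W *: Q by rewrite subrr.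
    have WE : W = - (C * x) + A * z + S * a1 by rewrite /W /S /A /B /C; ring.
    rewrite -{1}VE' WE S00; apply/rowP => k; rewrite !mxE; ring.
  by rewrite oppr_eq0 mulf_eq0 (negbTE C0) (negbTE x0).
split.
  apply/rank_col3P; exists (C * a2), (A * a3), (- W); rewrite mulf_neq0 //; split=> //.
  have -> : 0 = V - W *: Q by [].
  by rewrite /V /W; apply/rowP => k; rewrite !mxE; ring.
(* Normalising the factor at [O] to 1, the relations of [black_coeffs] become Moutard equations with
   coefficients [A^-1], [B^-1], [C^-1]; at [Q] the lift is [V / S]. *)
exists 1, a1, a2, a3, (x / A), (y / B), (z / C), (W / S).
have QE : Q = W^-1 *: V by rewrite VE scalerA mulVf ?scale1r.
have one0 : (1 : R) != 0 := oner_neq0 _.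
have nz1 : x / A != 0 by rewrite mulf_neq0 ?invr_eq0.
have nz2 : y / B != 0 by rewrite mulf_neq0 ?invr_eq0.
have nz3 : z / C != 0 by rewrite mulf_neq0 ?invr_eq0.
have nz4 : W / S != 0 by rewrite mulf_neq0 ?invr_eq0.
split; split; split=> //.
- exists A^-1; first by rewrite /A; field.
  by rewrite E12; apply/rowP => k; rewrite !mxE /A; field; apply/andP; split.
- exists B^-1; first by rewrite /B; field.
  by rewrite E23; apply/rowP => k; rewrite !mxE /B; field; apply/andP; split.
- exists C^-1; first by rewrite /C; field.
  by rewrite E31; apply/rowP => k; rewrite !mxE /C; field; apply/andP; split.
(* Star-triangle relation: the pairwise products of [A^-1], [B^-1], [C^-1] sum to [S / (A * B * C)].
   Dividing the coefficient [B^-1] of the opposite face by this sum gives [A * C / S], up to sign;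
   the other two are analogous. *)
- exists (- (A * C / S)).
    rewrite /W; transitivity ((B * a1 + C * a2 + A * a3 - a1 * S) / S); first by field.
    transitivity ((A * z - x * C) / S); last by field; rewrite S00 A0 C0.
    by congr (_ / _); rewrite /A /B /C /S; ring.
  rewrite QE V1; apply/rowP => k; rewrite !mxE; field.
  by rewrite W0 S00 A0 C0.
- exists (- (A * B / S)).
    rewrite /W; transitivity ((B * a1 + C * a2 + A * a3 - a2 * S) / S); first by field.
    transitivity ((B * x - y * A) / S); last by field; rewrite S00 A0 B0.
    by congr (_ / _); rewrite /A /B /C /S; ring.
  rewrite QE V2; apply/rowP => k; rewrite !mxE; field.
  by rewrite W0 S00 A0 B0.
- exists (- (B * C / S)).
    rewrite /W; transitivity ((B * a1 + C * a2 + A * a3 - a3 * S) / S); first by field.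
    transitivity ((C * y - z * B) / S); last by field; rewrite S00 B0 C0.
    by congr (_ / _); rewrite /A /B /C /S; ring.
  rewrite QE V3; apply/rowP => k; rewrite !mxE; field.
  by rewrite W0 S00 B0 C0.
Qed.

(** Comparing the two expansions of [C - A] in the basis [B - A], [D - A] shows that a lift is
    unique up to one scale on the pair [A], [C] and one on the pair [B], [D]. Each side has one end
    in either pair, so all side products change by the same factor. *)
Lemma moutard_prop kA kB kC kD kA' kB' kC' kD' A B C D :
  ~ collinear3 A B D -> A <> C ->
  moutard kA kB kC kD A B C D -> moutard kA' kB' kC' kD' A B C D ->
  exists2 t : R, t != 0 &
    [/\ kA' * kB' = t * (kA * kB), kA' * kD' = t * (kA * kD),
        kB' * kC' = t * (kB * kC) & kD' * kC' = t * (kD * kC)].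
Proof.
move=> ncol nAC.
have dE (a b c d m : R) : c != 0 -> c - a = m * (b - d) ->
    c *: C - a *: A = m *: (b *: B - d *: D) ->
    C - A = (m * b / c) *: (B - A) - (m * d / c) *: (D - A).
  move=> c0 ew ev; have aE : a = c - m * (b - d) by rewrite -ew subKr.
  apply: (scalerI c0); transitivity (c *: C - a *: A - (c - a) *: A).
    by apply/rowP => k; rewrite !mxE; ring.
  by rewrite ev ew; apply/rowP => k; rewrite !mxE; field.
move=> [[kA0 kB0 kC0 kD0] [m ew ev]] [[kA'0 kB'0 kC'0 kD'0] [m' ew' ev']].
have E := dE _ _ _ _ _ kC0 ew ev; have E' := dE _ _ _ _ _ kC'0 ew' ev'.
have [|/eqP h1 /eqP h2] := @collinear3_free A B D
  (m * kB / kC - m' * kB' / kC') (m' * kD' / kC' - m * kD / kC) ncol.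
  rewrite -[RHS](subrr (C - A)) {1}E E'; apply/rowP => k; rewrite !mxE; ring.
have m0 : m != 0.
  apply/negP => /eqP m0; apply: nAC; apply/esym/eqP; rewrite -subr_eq0 E m0.
  by rewrite !mul0r !scale0r subrr.
have {}h1 : m' * kB' / kC' = m * kB / kC by apply/esym/eqP; rewrite -subr_eq0.
have {}h2 : m' * kD' / kC' = m * kD / kC by apply/eqP; rewrite -subr_eq0.
have hA : kA' = kC' * (kA / kC).
  have -> : kA = kC - m * (kB - kD) by rewrite -ew subKr.
  have -> : kA' = kC' - m' * (kB' - kD') by rewrite -ew' subKr.
  transitivity (kC' * (1 - (m' * kB' / kC' - m' * kD' / kC'))); first by field.
  by rewrite h1 h2; field.
have m'0 : m' != 0.
  apply/negP => /eqP m'0; move/eqP: h1; rewrite m'0 !mul0r eq_sym.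
  by rewrite !mulf_eq0 invr_eq0 (negbTE m0) (negbTE kB0) (negbTE kC0).
have hB : kB' = (m * kC' / (m' * kC)) * kB.
  by apply: (mulfI m'0); apply: (mulIf (invr_neq0 kC'0)); rewrite h1; field;
     rewrite ?kC0 ?m'0 ?kC'0.
have hD : kD' = (m * kC' / (m' * kC)) * kD.
  by apply: (mulfI m'0); apply: (mulIf (invr_neq0 kC'0)); rewrite h2; field;
     rewrite ?kC0 ?m'0 ?kC'0.
exists (m * kC' / (m' * kC) * (kC' / kC)).
  by rewrite !mulf_neq0 ?invr_eq0 ?mulf_neq0.
by rewrite hA hB hD; split; field; rewrite ?kC0 ?m'0.
Qed.

(** * Dual quadrilaterals and their non-degeneracy *)

Lemma collinear3_swap A B C : ~ collinear3 A B C -> ~ collinear3 A C B.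
Proof.
move=> nc /rank_col2P[x [y [n0 e0]]]; apply: nc; apply/rank_col2P.
by exists y, x; rewrite orbC addrC.
Qed.

Lemma noncollinear_fork p q A B C A' B' C' : p != 0 -> q != 0 ->
  B' - A' = p *: (B - A) -> C' - A' = q *: (C - A) ->
  ~ collinear3 A B C -> ~ collinear3 A' B' C'.
Proof.
move=> p0 q0 e1 e2 nc /rank_col2P[x [y [n0]]]; rewrite e1 e2 !scalerA.
move=> /(collinear3_free nc)[/eqP + /eqP].
rewrite !mulf_eq0 (negbTE p0) (negbTE q0) !orbF => x0 y0.
by rewrite x0 y0 in n0.
Qed.

Lemma noncollinear_path p q A B C A' B' C' : p != 0 -> q != 0 ->
  B' - A' = p *: (B - A) -> C' - B' = q *: (C - B) ->
  ~ collinear3 A B C -> ~ collinear3 A' B' C'.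
Proof.
move=> p0 q0 e1 e2 nc /rank_col2P[x [y [n0]]].
rewrite -[C' - A'](subrKA B') e1 e2 => e0.
have [|/eqP + /eqP] := @collinear3_free _ _ _ ((x + y) * p - y * q) (y * q) nc.
  by rewrite -e0; apply/rowP => k; rewrite !mxE; ring.
rewrite mulf_eq0 (negbTE q0) orbF => /[swap] /eqP y0; move: n0.
by rewrite y0 addr0 mul0r subr0 mulf_eq0 (negbTE p0) orbF eqxx orbF => /negbTE->.
Qed.

Lemma noncollinear_neq A B C : ~ collinear3 A B C -> [/\ A <> B, A <> C & B <> C].
Proof.
move=> nc; split=> e0; apply: nc; apply/rank_col2P; rewrite e0.
- by exists 1, 0; rewrite oner_neq0 subrr scaler0 scale0r addr0.
- by exists 0, 1; rewrite oner_neq0 orbT subrr scaler0 scale0r addr0.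
- by exists 1, (- 1); rewrite oner_neq0 scaleNr subrr.
Qed.

Lemma parallel_scaled (c : R) u v : u = c *: v -> parallel u v.
Proof.
move=> ->; apply/rank_col2P; exists 1, (- c); rewrite oner_neq0; split=> //.
by rewrite scale1r scaleNr subrr.
Qed.

Lemma parallel_scale u v : parallel u v -> u <> 0 -> exists c : R, v = c *: u.
Proof.
move=> /rank_col2P[x [y [n0 e0]]] u0; have [y0|y0] := eqVneq y 0.
  move: e0 n0; rewrite y0 scale0r addr0 eqxx orbF => /eqP.
  by rewrite scaler_eq0 => /orP[/eqP->|/eqP/u0//]; rewrite eqxx.
exists (- x / y); apply: (scalerI y0); apply/eqP; rewrite -subr_eq0 -[X in _ == X]e0.
by apply/eqP/rowP => k; rewrite !mxE; field.
Qed.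

(** Nonzero factors on two sides carry the non-collinearity of a triple over to the dual; the
    diagonal factors locate the new diagonal point. *)
Lemma nondeg_dual_quad (p1 p2 p3 p4 c d : R) A B C D A' B' C' D' :
  p1 != 0 -> p2 != 0 -> p3 != 0 -> p4 != 0 -> c != 0 -> d != 0 ->
  B' - A' = p1 *: (B - A) -> C' - B' = p2 *: (C - B) ->
  D' - C' = p3 *: (D - C) -> D' - A' = p4 *: (D - A) ->
  C' - A' = c *: (D - B) -> D' - B' = d *: (C - A) -> nondeg_quad A B C D ->
  [/\ dual_quad A B C D A' B' C' D', coplanar4 A' B' C' D'
    & nondeg_quad A' B' C' D'].
Proof.
move=> p10 p20 p30 p40 c0 d0 e1 e2 e3 e4 ec ed nd; split.
- have p := parallel_scaled; split; last split; last split; last split; last split.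
  + exact: p e1.
  + exact: p e2.
  + exact: p e3.
  + by apply: (@parallel_scaled p4); rewrite -opprB e4 -scalerN opprB.
  + exact: p ec.
  + exact: p ed.
- apply/rank_col3P; exists (c / p1), 1, (- (c / p4)).
  rewrite oner_neq0 orbT; split=> //; rewrite ec e1 e4.
  by apply/rowP => k; rewrite !mxE; field; rewrite p10 p40.
have [s [t [[s0 s1 t0 t1] e0]]] := nondeg_quad_diag nd.
case: nd => _ [[nABC [nABD [nACD nBCD]]] _].
have e3' : C' - D' = p3 *: (C - D) by rewrite -opprB e3 -scalerN opprB.
have nABC' := noncollinear_path p10 p20 e1 e2 nABC.
have nABD' := noncollinear_fork p10 p40 e1 e4 nABD.
have nACD' := collinear3_swap (noncollinear_path p40 p30 e4 e3' (collinear3_swap nACD)).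
have nBCD' := noncollinear_path p20 p30 e2 e3 nBCD.
have [AB' nAC' BC'] := noncollinear_neq nABC'.
have [_ AD' BD'] := noncollinear_neq nABD'.
have [_ _ CD'] := noncollinear_neq nACD'.
split=> //; split=> //.
(* Obtained by matching coefficients after writing [B - A] as [s *: (C - A) - t *: (D - B)]. *)
pose x := - (p1 * t / c); pose y := - (p1 * s / d).
have x0 : x != 0 by rewrite oppr_eq0 !mulf_neq0 ?invr_eq0.
have y0 : y != 0 by rewrite oppr_eq0 !mulf_neq0 ?invr_eq0.
have PE : A' + x *: (C' - A') = B' + y *: (D' - B').
  apply/eqP; rewrite -subr_eq0; apply/eqP.
  transitivity (x *: (C' - A') - y *: (D' - B') - (B' - A')).
    by apply/rowP => k; rewrite !mxE; ring.
  rewrite ec ed e1; move/rowP: e0 => e0.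
  apply/rowP => k; move: (e0 k); rewrite !mxE => hk.
  transitivity (p1 * ((1 - s) * A 0 k + s * C 0 k - ((1 - t) * B 0 k + t * D 0 k))).
    by rewrite /x /y; field; rewrite c0 d0.
  by rewrite hk subrr mulr0.
clearbody x y.
exists (A' + x *: (C' - A')); split; first by exists x.
split; first by exists y.
have nz a u : a != 0 -> u <> 0 -> a *: u <> 0.
  by move=> a0 u0 /eqP; rewrite scaler_eq0 (negbTE a0) => /eqP.
have sub0 (u v : 'rV[R]_N) : u <> v -> v - u <> 0.
  by move=> uv /eqP; rewrite subr_eq0 => /eqP vu; apply: uv.
split; first by rewrite -[X in _ <> X]addr0 => /addrI; exact/nz/sub0.
split; first by rewrite PE -[X in _ <> X]addr0 => /addrI; exact/nz/sub0.
split.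
  rewrite PE => h; apply: nBCD'; apply/rank_col2P; exists 1, (- y).
  by rewrite oner_neq0 -h [B' + _]addrC addrK scale1r scaleNr subrr.
move=> h; apply: nACD'; apply/rank_col2P; exists x, (- 1).
by rewrite x0 -h [A' + _]addrC addrK scaleN1r subrr.
Qed.

(** The difference of the two sides is [s] times a 2 by 2 determinant of the lifted diagonals,
    weights against positions; it vanishes since the Moutard equation makes these diagonals
    proportional. *)
Lemma moutard_closed (s kA kB kC kD : R) A B C D : moutard kA kB kC kD A B C D ->
  (s * (kA * kB)) *: (B - A) + (s * (kB * kC)) *: (C - B) =
  (s * (kA * kD)) *: (D - A) + (s * (kD * kC)) *: (C - D).
Proof.
move=> [_ [m ew /rowP ev]]; apply/rowP => k; move: (ev k); rewrite !mxE => evk.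
apply/eqP; rewrite -subr_eq0; apply/eqP.
transitivity (s * ((kB - kD) * (kC * C 0 k - kA * A 0 k)
                   - (kC - kA) * (kB * B 0 k - kD * D 0 k))); first by ring.
by rewrite evk ew; ring.
Qed.

(* Edge factors [kA kB], ... turn a Moutard lift into a dual quadrilateral;
   the opposite diagonals come with factors [m kB kD] and [kA kC / m]. *)
Lemma moutard_dual (s kA kB kC kD : R) A B C D A' B' C' D' :
  s != 0 -> moutard kA kB kC kD A B C D -> nondeg_quad A B C D ->
  B' - A' = (s * (kA * kB)) *: (B - A) -> C' - B' = (s * (kB * kC)) *: (C - B) ->
  D' - A' = (s * (kA * kD)) *: (D - A) -> C' - D' = (s * (kD * kC)) *: (C - D) ->
  [/\ dual_quad A B C D A' B' C' D', coplanar4 A' B' C' D'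
    & nondeg_quad A' B' C' D'].
Proof.
move=> s0 [[kA0 kB0 kC0 kD0] [m ew ev]] nd e1 e2 e4 e3.
have m0 : m != 0.
  apply/negP => /eqP m0; case: nd => [[_ [nAC _]] _]; apply: nAC.
  have kCA : kC = kA by apply/eqP; rewrite -subr_eq0 ew m0 mul0r.
  apply: (scalerI kA0); apply/esym/eqP; rewrite -subr_eq0 -{1}kCA ev m0.
  by rewrite scale0r.
have evk k : kC * C 0 k = kA * A 0 k + m * (kB * B 0 k - kD * D 0 k).
  by move/rowP/(_ k): ev; rewrite !mxE => <-; rewrite [RHS]addrC subrK.
apply: (@nondeg_dual_quad (s * (kA * kB)) (s * (kB * kC)) (s * (kD * kC))
  (s * (kA * kD)) (- (s * m * kB * kD)) (- (s * kA * kC / m))) => //.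
- by rewrite !mulf_neq0.
- by rewrite !mulf_neq0.
- by rewrite !mulf_neq0.
- by rewrite !mulf_neq0.
- by rewrite oppr_eq0 !mulf_neq0.
- by rewrite oppr_eq0 !mulf_neq0 ?invr_eq0.
- by rewrite -opprB e3 -scalerN opprB.
- rewrite -[C' - A'](subrKA B') e1 e2; apply/rowP => k; rewrite !mxE.
  transitivity (s * kB * (kC * C 0 k - kA * A 0 k - (kC - kA) * B 0 k)); first by ring.
  by rewrite evk ew; ring.
- rewrite -[D' - B'](subrKA A') -[A' - B']opprB e1 e4; apply/rowP => k.
  rewrite !mxE; apply: (mulfI m0).
  transitivity (- (s * kA * (m * (kB * B 0 k - kD * D 0 k) - m * (kB - kD) * A 0 k)));
    first by ring.
  have -> : m * (kB * B 0 k - kD * D 0 k) = kC * C 0 k - kA * A 0 k.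
    by rewrite evk [RHS]addrC addKr.
  by rewrite -ew; field.
Qed.

End Points.

(** * Integration of closed discrete 1-forms on Z^3 *)

Section Transport.
Variable X : Type.

(** [h n] leads from position n to n + 1, so the step down from -k to -(k+1), which is [Negz k],
    must undo [h (Negz k)]. *)
Definition line (h h' : int -> X -> X) (x : X) (n : int) : X :=
  match n with
  | Posz n => iteri n (fun k => h k%:Z) x
  | Negz n => iteri n.+1 (fun k => h' (Negz k)) x
  end.

Lemma line_step h h' x : (forall n, cancel (h' n) (h n)) ->
  forall n, line h h' x (n + 1) = h n (line h h' x n).
Proof.
move=> hK [n|[|n]].
- by rewrite -PoszD addn1.
- by rewrite /= hK.
- have -> : Negz n.+1 + 1 = Negz n by rewrite !NegzE -[in LHS](addn1 n.+1) PoszD opprD subrK.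
  by rewrite [in RHS]/= hK.
Qed.

Lemma step_uniq (h : int -> X -> X) (s s' : int -> X) :
  (forall n, injective (h n)) -> (forall n, s (n + 1) = h n (s n)) ->
  (forall n, s' (n + 1) = h n (s' n)) -> s 0 = s' 0 -> s =1 s'.
Proof.
move=> hI sS s'S s0 n; elim/int_ind: n => // n IH.
  by rewrite -addn1 PoszD sS s'S IH.
by apply: (hI (- n.+1%:Z)); rewrite -sS -s'S -addn1 PoszD opprD subrK.
Qed.

Definition Z3_of (x y z : int) : Z3 := e i1 *~ x + e i2 *~ y + e i3 *~ z.

Lemma ord3_ind (P : 'I_3 -> Prop) : P i1 -> P i2 -> P i3 -> forall i, P i.
Proof.
move=> P1 P2 P3 [[|[|[|//]]] lt]; [move: P1|move: P2|move: P3];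
  by congr P; apply: val_inj.
Qed.

Lemma Z3_ofK (u : Z3) : Z3_of (u 0 i1) (u 0 i2) (u 0 i3) = u.
Proof.
apply/rowP; elim/ord3_ind; rewrite /Z3_of -!scaler_int !mxE !intz /=;
  by rewrite ?mulr0 ?mulr1 ?addr0 ?add0r.
Qed.

Lemma Z3_connected (P : Z3 -> Prop) :
  P 0 -> (forall u i, P u <-> P (u + e i)) -> forall u, P u.
Proof.
move=> P0 Pe u.
have Pline i v n : P v -> P (v + e i *~ n).
  move=> Pv; elim/int_ind: n => [|n IH|n IH]; first by rewrite mulr0z addr0.
    by rewrite -(addn1 n) PoszD mulrzDr mulr1z addrA; exact: (iffLR (Pe _ i)).
  by apply: (iffRL (Pe _ i)); rewrite -(addn1 n) PoszD opprD mulrzBr mulr1z addrA subrK.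
by rewrite -(Z3_ofK u) /Z3_of -[e i1 *~ _]add0r; exact/Pline/Pline/Pline.
Qed.

(** A form is a family of bijections along edges that commute around squares, which covers both
    scalings of [R] and translations of vectors. The solution is built along the first axis, then
    the second, then the third. *)
Lemma Z3_transport (x0 : X) (g g' : 'I_3 -> Z3 -> X -> X) :
  (forall i u, cancel (g i u) (g' i u)) -> (forall i u, cancel (g' i u) (g i u)) ->
  (forall i j u x, g j (u + e i) (g i u x) = g i (u + e j) (g j u x)) ->
  exists2 s : Z3 -> X, s 0 = x0 & forall u i, s (u + e i) = g i u (s u).
Proof.
move=> gK g'K gC.
have gI i u : injective (g i u) := can_inj (gK i u).
pose s1 x := line (fun n => g i1 (Z3_of n 0 0)) (fun n => g' i1 (Z3_of n 0 0)) x0 x.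
pose s2 x y := line (fun n => g i2 (Z3_of x n 0)) (fun n => g' i2 (Z3_of x n 0)) (s1 x) y.
pose s3 x y z := line (fun n => g i3 (Z3_of x y n)) (fun n => g' i3 (Z3_of x y n)) (s2 x y) z.
have Z1 x y z : Z3_of (x + 1) y z = Z3_of x y z + e i1.
  by rewrite /Z3_of mulrzDr mulr1z [e i1 *~ x + _ + _]addrAC [LHS]addrAC.
have Z2 x y z : Z3_of x (y + 1) z = Z3_of x y z + e i2.
  by rewrite /Z3_of mulrzDr mulr1z addrA [LHS]addrAC.
have Z_3 x y z : Z3_of x y (z + 1) = Z3_of x y z + e i3.
  by rewrite /Z3_of mulrzDr mulr1z addrA.
have S1 n : s1 (n + 1) = g i1 (Z3_of n 0 0) (s1 n) by exact: line_step.
have S2 x y : s2 x (y + 1) = g i2 (Z3_of x y 0) (s2 x y) by exact: line_step.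
have S3 x y z : s3 x y (z + 1) = g i3 (Z3_of x y z) (s3 x y z) by exact: line_step.
(* By commutation both sides obey the same recurrence in [y], and they agree at 0; [S31] and [S32]
   repeat this in [z]. *)
have S21 x y : s2 (x + 1) y = g i1 (Z3_of x y 0) (s2 x y).
  move: y; apply: (@step_uniq (fun n => g i2 (Z3_of (x + 1) n 0))) => //.
    by move=> y; rewrite S2 Z2 Z1 gC.
  exact: S1.
have S31 x y z : s3 (x + 1) y z = g i1 (Z3_of x y z) (s3 x y z).
  move: z; apply: (@step_uniq (fun n => g i3 (Z3_of (x + 1) y n))) => //.
    by move=> z; rewrite S3 Z_3 Z1 gC.
  exact: S21.
have S32 x y z : s3 x (y + 1) z = g i2 (Z3_of x y z) (s3 x y z).
  move: z; apply: (@step_uniq (fun n => g i3 (Z3_of x (y + 1) n))) => //.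
    by move=> z; rewrite S3 Z_3 Z2 gC.
  exact: S2.
exists (fun u : Z3 => s3 (u 0 i1) (u 0 i2) (u 0 i3)); first by rewrite !mxE.
move=> u; elim/ord3_ind; rewrite !mxE /= ?addr0.
- by rewrite S31 Z3_ofK.
- by rewrite S32 Z3_ofK.
- by rewrite S3 Z3_ofK.
Qed.

End Transport.

(** Extends eight vertex values to all of Z^3, so that face conditions can be stated uniformly in
    the position and the two directions. The values off the cube are arbitrary. *)
Definition cube_table {R : Type} (u : Z3) (k k1 k2 k3 k12 k23 k31 k123 : R) (v : Z3) : R :=
  let d i := (v - u) 0 i == 1 in
  if d i1 then if d i2 then if d i3 then k123 else k12
               else if d i3 then k31 else k1
  else if d i2 then if d i3 then k23 else k2
       else if d i3 then k3 else k.

Lemma cube_tableE {R : Type} (u : Z3) (k k1 k2 k3 k12 k23 k31 k123 : R) :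
  let K := cube_table u k k1 k2 k3 k12 k23 k31 k123 in
  [/\ K u = k, [/\ K (u + e i1) = k1, K (u + e i2) = k2 & K (u + e i3) = k3],
      [/\ K (u + e i1 + e i2) = k12, K (u + e i2 + e i3) = k23
        & K (u + e i1 + e i3) = k31]
    & K (u + e i1 + e i2 + e i3) = k123].
Proof.
have E a : u + a - u = a by rewrite addrC addKr.
have E2 a b : u + a + b - u = a + b by rewrite -(addrA u) E.
have E3 a b c : u + a + b + c - u = a + b + c by rewrite -2!(addrA u) E.
rewrite /= /cube_table subrr E3 !E2 !E.
by rewrite !mxE.
Qed.

#[local] Opaque e.

(** * Koenigs nets and the coplanarity conditions *)

Section KoenigsNets.
Context {R : realFieldType} {N : nat}.
Variable f : Z3 -> 'rV[R]_N.
Hypothesis Hq : Qnet f.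
Hypothesis Hhex : forall u, nondeg_hex f u.

Lemma Qnet_nondeg u i j : i != j ->
  nondeg_quad (f u) (f (u + e i)) (f (u + e i + e j)) (f (u + e j)).
Proof. by move=> ij; have [] := Hq u ij. Qed.

Lemma Z3_add3E (u : Z3) : (u + e i2 + e i3 + e i1 = u + e i1 + e i2 + e i3) *
  (u + e i1 + e i3 + e i2 = u + e i1 + e i2 + e i3) *
  (u + e i3 + e i1 = u + e i1 + e i3) * (u + e i2 + e i1 = u + e i1 + e i2) *
  (u + e i3 + e i2 = u + e i2 + e i3).
Proof.
have swap (w a b : Z3) : w + a + b = w + b + a := addrAC w a b.
rewrite (swap (u + e i2)) ![u + e i2 + _]swap; do !split.
- exact: swap.
- exact: swap.
Qed.

Lemma hex_quads u :
  [/\ quad_diag (f u) (f (u + e i1)) (f (u + e i1 + e i2)) (f (u + e i2)),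
      quad_diag (f u) (f (u + e i2)) (f (u + e i2 + e i3)) (f (u + e i3))
    & quad_diag (f u) (f (u + e i3)) (f (u + e i1 + e i3)) (f (u + e i1))] /\
  [/\ quad_diag (f (u + e i1)) (f (u + e i1 + e i2))
        (f (u + e i1 + e i2 + e i3)) (f (u + e i1 + e i3)),
      quad_diag (f (u + e i2)) (f (u + e i2 + e i3))
        (f (u + e i1 + e i2 + e i3)) (f (u + e i1 + e i2))
    & quad_diag (f (u + e i3)) (f (u + e i1 + e i3))
        (f (u + e i1 + e i2 + e i3)) (f (u + e i2 + e i3))].
Proof.
have q v i j ij := nondeg_quad_diag (@Qnet_nondeg v i j ij).
have E := Z3_add3E u.
have q31 := q u i3 i1 isT; have q2 := q (u + e i2) i3 i1 isT.
have q3 := q (u + e i3) i1 i2 isT.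
rewrite !E in q31 q2 q3.
have q12 := q u i1 i2 isT; have q23 := q u i2 i3 isT.
by have q1 := q (u + e i1) i2 i3 isT.
Qed.

Lemma hex_spans u :
  [/\ spans3 (f u) (f (u + e i1)) (f (u + e i2)) (f (u + e i3)),
      spans3 (f (u + e i1 + e i2 + e i3)) (f (u + e i1 + e i2))
        (f (u + e i2 + e i3)) (f (u + e i1 + e i3)),
      spans3 (f (u + e i1)) (f u) (f (u + e i1 + e i2)) (f (u + e i1 + e i3))
    & spans3 (f (u + e i2 + e i3)) (f (u + e i2))
        (f (u + e i1 + e i2 + e i3)) (f (u + e i3))].
Proof.
have [S0 S] := Hhex u.
have := S true true true; have := S true false false; have := S false true true.
rewrite /hexv /= !mulr0n !mulr1n !addr0 => S1 S2 S3; split=> //.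
- exact: spans3_perm (spans3_perm S3).
- exact: spans3_perm (spans3_perm S1).
Qed.

Lemma black_white u : black_coplanar f u -> white_coplanar f u.
Proof.
have [S0 SQ _ _] := hex_spans u; have [[q12 q23 q31] [q1 q2 q3]] := hex_quads u.
by move=> /(cube_moutard S0 SQ q12 q23 q31 q1 q2 q3)[].
Qed.

(* The reflection of the cube that exchanges f and f_1 swaps the two colours. *)
Lemma white_black u : white_coplanar f u -> black_coplanar f u.
Proof.
have [_ _ S0 SQ] := hex_spans u; have [[q12 q23 q31] [q1 q2 q3]] := hex_quads u.
pose r := @quad_diag_rot R N; pose s := @quad_diag_flip R N.
move=> /coplanar4_swap.
(* The roles [O P1 P2 P3 P12 P23 P31 Q] are now played by f_1, f, f_12, f_13, f_2, f_123, f_3, f_23;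
   [r] and [s] reread the faces in the required cyclic order. *)
move=> /(cube_moutard S0 SQ (s _ _ _ _ (r _ _ _ _ q12)) q1
  (s _ _ _ _ (r _ _ _ _ (r _ _ _ _ (r _ _ _ _ q31)))) q23
  (s _ _ _ _ (r _ _ _ _ (r _ _ _ _ (r _ _ _ _ q2))))
  (s _ _ _ _ (r _ _ _ _ q3)))[+ _].
exact: coplanar4_swap.
Qed.

Lemma koenigs_black : koenigs f -> forall u, black_coplanar f u.
Proof.
move=> [fs [Hfs dual]] u.
have diag i j : i != j ->
    exists2 m, m != 0 & f (u + e i + e j) - f u = m *: (fs (u + e j) - fs (u + e i)).
  move=> ij; have [_ [_ [_ [_ [_ par]]]]] := dual u i j ij.
  have [_ [[_ [_ [_ [_ [BD _]]]]] _]] := Hfs u i j ij.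
  have [|m mE] := parallel_scale par.
    by move/eqP; rewrite subr_eq0 => /eqP DB; apply: BD.
  exists m => //; apply/negP => /eqP m0.
  have [[_ [fAC _]] _] := Qnet_nondeg u ij; apply: fAC.
  by apply/esym/eqP; rewrite -subr_eq0 mE m0 scale0r.
have [m3 m30 E3] := diag i1 i2 isT; have [m1 m10 E1] := diag i2 i3 isT.
have [m2 m20] := diag i3 i1 isT; rewrite !Z3_add3E => E2.
(* These weights turn each term into [m1 * m2 * m3] times a side of the dual triangle. *)
apply/rank_col3P; exists (m1 * m2), (m2 * m3), (m3 * m1).
rewrite !mulf_neq0 //; split=> //; rewrite E1 E2 E3.
by apply/rowP => k; rewrite !mxE; ring.
Qed.

Definition quad_ok (k : Z3 -> R) v i j : Prop :=
  moutard (k v) (k (v + e i)) (k (v + e i + e j)) (k (v + e j))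
    (f v) (f (v + e i)) (f (v + e i + e j)) (f (v + e j)).

Lemma quad_ok_sym k v i j : quad_ok k v i j -> quad_ok k v j i.
Proof. by move=> /moutard_flip; rewrite /quad_ok [v + e j + e i]addrAC. Qed.

Definition cube_ok (k : Z3 -> R) u : Prop :=
  (forall i j, i != j -> quad_ok k u i j) /\
  (forall l i j, i != j -> i != l -> j != l -> quad_ok k (u + e l) i j).

Lemma black_cube u : black_coplanar f u -> exists k, cube_ok k u.
Proof.
have [S0 SQ _ _] := hex_spans u; have [[q12 q23 q31] [q1 q2 q3]] := hex_quads u.
move=> /(cube_moutard S0 SQ q12 q23 q31 q1 q2 q3)[_].
move=> [k [k1 [k2 [k3 [k12 [k23 [k31 [k123 [[m12 m23 m31] [m1 m2 m3]]]]]]]]]].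
exists (cube_table u k k1 k2 k3 k12 k23 k31 k123).
have [E0 [E1 E2 E3] [E12 E23 E31] E123] :=
  cube_tableE u k k1 k2 k3 k12 k23 k31 k123.
set K := cube_table _ _ _ _ _ _ _ _ _ in E0 E1 E2 E3 E12 E23 E31 E123 *.
have b12 : quad_ok K u i1 i2 by rewrite /quad_ok E0 E1 E2 E12.
have b23 : quad_ok K u i2 i3 by rewrite /quad_ok E0 E2 E3 E23.
have b31 : quad_ok K u i3 i1 by rewrite /quad_ok !Z3_add3E E0 E1 E3 E31.
have c1 : quad_ok K (u + e i1) i2 i3 by rewrite /quad_ok E1 E12 E31 E123.
have c2 : quad_ok K (u + e i2) i3 i1.
  by rewrite /quad_ok !Z3_add3E E2 E12 E23 E123.
have c3 : quad_ok K (u + e i3) i1 i2.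
  by rewrite /quad_ok !Z3_add3E E3 E31 E23 E123.
have sym v i j : quad_ok K v i j -> quad_ok K v j i by exact: quad_ok_sym.
rewrite /cube_ok; move: (quad_ok K) sym b12 b23 b31 c1 c2 c3 => Q sym *; split.
  by elim/ord3_ind; elim/ord3_ind => // _; exact: sym.
by elim/ord3_ind; elim/ord3_ind; elim/ord3_ind => // _ _ _; exact: sym.
Qed.

(* The dual of a quadrilateral is unique up to scale, so two cubes sharing a
   face have proportional dual edges there. *)
Lemma face_ratio k k' v l :
  (forall i j, i != j -> i != l -> j != l -> quad_ok k v i j /\ quad_ok k' v i j) ->
  exists2 t : R, t != 0 & forall i j, i != j -> i != l -> j != l ->
    k v * k (v + e i) = t * (k' v * k' (v + e i)) /\
    k (v + e i) * k (v + e i + e j) = t * (k' (v + e i) * k' (v + e i + e j)).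
Proof.
pose E i j t := k v * k (v + e i) = t * (k' v * k' (v + e i)) /\
    k (v + e i) * k (v + e i + e j) = t * (k' (v + e i) * k' (v + e i + e j)).
move=> ok.
have P i j : i != j -> i != l -> j != l ->
    exists2 t : R, t != 0 & E i j t /\ E j i t.
  move=> ij il jl; have [ok1 ok2] := ok i j ij il jl.
  have [[_ [nAC _]] [[_ [nABD _]] _]] := Qnet_nondeg v ij.
  have [t t0 [tAB tAD tBC tDC]] := moutard_prop nABD nAC ok2 ok1.
  by exists t => //; split; split; rewrite // [v + e j + e i]addrAC.
(* For fixed [l] only one unordered pair of directions remains, so one [t] serves both orders. *)
move: l P {ok}; elim/ord3_ind => P.
- have [t t0 [? ?]] := P i2 i3 isT isT isT; exists t => //.
  by elim/ord3_ind; elim/ord3_ind.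
- have [t t0 [? ?]] := P i3 i1 isT isT isT; exists t => //.
  by elim/ord3_ind; elim/ord3_ind.
- have [t t0 [? ?]] := P i1 i2 isT isT isT; exists t => //.
  by elim/ord3_ind; elim/ord3_ind.
Qed.

Lemma third_index (i j : 'I_3) : i != j -> exists2 l : 'I_3, i != l & j != l.
Proof.
by move: i j; elim/ord3_ind; elim/ord3_ind => // _;
  by [exists i1|exists i2|exists i3].
Qed.

Lemma black_koenigs : (forall u, black_coplanar f u) -> koenigs f.
Proof.
move=> black.
have [K Kok] := functional_choice _ (fun u => black_cube (black u)).
(* The dual factor of the edge at [v] in direction [i], as computed in the cube at [u]. *)
pose w u v i := K u v * K u (v + e i).
have ratio (x : Z3 * 'I_3) : exists t : R, t != 0 /\
    forall i j, i != j -> i != x.2 -> j != x.2 ->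
      w x.1 (x.1 + e x.2) i = t * w (x.1 + e x.2) (x.1 + e x.2) i /\
      w x.1 (x.1 + e x.2 + e i) j = t * w (x.1 + e x.2) (x.1 + e x.2 + e i) j.
  case: x => u l /=.
  have [|r r0 rE] := @face_ratio (K u) (K (u + e l)) (u + e l) l.
    move=> i j ij il jl; split; first exact: (Kok u).2.
    exact: (Kok (u + e l)).1.
  by exists r.
have [t tE] := functional_choice _ ratio.
have w0 u i : w u u i != 0.
  have [j ij] : exists j, i != j.
    by move: i; elim/ord3_ind; [exists i2|exists i1|exists i1].
  by have [[kA kB _ _] _] := (Kok u).1 i j ij; rewrite mulf_neq0.
have [s s0 sE] : exists2 s : Z3 -> R, s 0 = 1 &
    forall u i, s (u + e i) = t (u, i) * s u.
  apply: (@Z3_transport _ 1 (fun i u x => t (u, i) * x)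
    (fun i u x => (t (u, i))^-1 * x)).
  - by move=> i u x; rewrite mulKf // (tE (u, i)).1.
  - by move=> i u x; rewrite mulVKf // (tE (u, i)).1.
  - move=> i j u x; have [->//|ij] := eqVneq i j.
    have [l il jl] := third_index ij.
    (* The edge at [u + e i + e j] in direction [l] lies in all four cubes. Multiplied by its factor
       in the last cube, either product of ratios yields its factor in the cube at [u]. *)
    rewrite !mulrA; congr (_ * _); apply: (mulIf (w0 (u + e i + e j) l)).
    have [_ h] := tE (u, i).
    have [/= _ h1] := h j l jl ltac:(by rewrite eq_sym) ltac:(by rewrite eq_sym).
    have [_ {}h] := tE (u + e i, j).
    have [/= h2 _] := h l i ltac:(by rewrite eq_sym) ltac:(by rewrite eq_sym) ij.
    have [_ {}h] := tE (u, j).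
    have [/= _ h3] := h i l il ij ltac:(by rewrite eq_sym).
    have [_ {}h] := tE (u + e j, i).
    have [/= h4 _] := h l j ltac:(by rewrite eq_sym) ltac:(by rewrite eq_sym)
      ltac:(by rewrite eq_sym).
    rewrite [t (u + e i, j) * _]mulrC -mulrA -h2 -h1.
    by rewrite [u + e i + e j]addrAC [t (u + e j, i) * _]mulrC -mulrA -h4 -h3.
have sn0 : forall u, s u != 0.
  apply: Z3_connected => [|u i]; first by rewrite s0 oner_neq0.
  by rewrite sE mulf_eq0 (negbTE (tE (u, i)).1).
pose W u i := s u * w u u i.
(* After rescaling by [s], neighbouring cubes agree on shared edges, so all four edges of a face at
   [u] carry [s u] times products from a single lift. *)
have WE u i j : i != j -> W (u + e j) i = s u * w u (u + e j) i.
  move=> ij; have [l il jl] := third_index ij; have [_ h] := tE (u, j).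
  have [/= -> _] := h i l il ij ltac:(by rewrite eq_sym).
  by rewrite /W sE mulrA [s u * _]mulrC.
have [fs _ fsE] : exists2 fs : Z3 -> 'rV[R]_N, fs 0 = 0 &
    forall u i, fs (u + e i) = fs u + W u i *: (f (u + e i) - f u).
  apply: (@Z3_transport _ 0 (fun i u x => x + W u i *: (f (u + e i) - f u))
    (fun i u x => x - W u i *: (f (u + e i) - f u))).
  - by move=> i u x; rewrite addrK.
  - by move=> i u x; rewrite subrK.
  - move=> i j u x; have [->//|ij] := eqVneq i j.
    rewrite -!(addrA x); congr (x + _); rewrite !WE //; last by rewrite eq_sym.
    rewrite /W /w [u + e j + e i]addrAC.
    exact: (moutard_closed (s u) ((Kok u).1 i j ij)).
have dfs v i : fs (v + e i) - fs v = W v i *: (f (v + e i) - f v).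
  by rewrite fsE [_ + W v i *: _]addrC addrK.
have dualnet u i j : i != j ->
  [/\ dual_quad (f u) (f (u + e i)) (f (u + e i + e j)) (f (u + e j))
        (fs u) (fs (u + e i)) (fs (u + e i + e j)) (fs (u + e j)),
      coplanar4 (fs u) (fs (u + e i)) (fs (u + e i + e j)) (fs (u + e j))
    & nondeg_quad (fs u) (fs (u + e i)) (fs (u + e i + e j)) (fs (u + e j))].
  move=> ij; apply: (moutard_dual (sn0 u) ((Kok u).1 i j ij) (Qnet_nondeg u ij)).
  - exact: dfs.
  - by rewrite dfs WE // eq_sym.
  - exact: dfs.
  - by rewrite [u + e i + e j]addrAC dfs WE.
by exists fs; split=> u i j /(dualnet u)[].
Qed.

End KoenigsNets.

Theorem mainTheorem6 (R : realFieldType) (N : nat) (HN : (3 <= N)%N)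
  (f : Z3 -> 'rV[R]_N) (Hq : Qnet f) (Hhex : forall u : Z3, nondeg_hex f u) :
  (forall u : Z3, black_coplanar f u <-> white_coplanar f u) /\
  (koenigs f <-> forall u : Z3, black_coplanar f u).
Proof.
split=> [u|]; split.
- exact: black_white.
- exact: white_black.
- exact: koenigs_black.
- exact: black_koenigs.
Qed.
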